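(* Let $X$ be an infinite-dimensional separable Banach space not containing $\ell_1$. Then $I(X)=\omega^{\alpha}$ for some ordinal $\alpha<\omega_1$, where $I(X)$ is the Bourgain $\ell_1$-index of $X$.
   Context: Banach spaces are real; $S(X)=\{x\in X:\|x\|=1\}$; ''not containing $\ell_1$'' means having no subspace isomorphic to $\ell_1$. A tree is a countable, non-empty, partially ordered set $(T,\leq)$ such that for each $x\in T$ the set $\{y\in T:y<x\}$ is linearly ordered and finite. A tree on a set $X$ is such a set $T\subseteq\bigcup_{n\ge1}X^n$ with the extension order: $(x_1,\dots,x_m)\leq(y_1,\dots,y_n)$ iff $m\leq n$ and $x_i=y_i$ for $i\leq m$. $D(T)=\{x\in T: x<y\text{ for some }y\in T\}$; $T^0=T$, $T^{\alpha+1}=D(T^\alpha)$, and $T^\alpha=\bigcap_{\beta<\alpha}T^\beta$ for limit $\alpha$. $T$ is well-founded if it contains no infinite linearly ordered subset; for well-founded $T$, the order is $o(T)=\inf\{\alpha:T^\alpha=\emptyset\}$. An $\ell_1$-$K$-tree on a Banach space $X$ is a tree $T$ on $X$ with $T\subseteq\bigcup_{n\ge1}S(X)^n$ such that for each $(x_1,\dots,x_m)\in T$ there are constants $c,C>0$ with $c^{-1}C\leq K$ and $c\sum_1^m|a_i|\leq\|\sum_1^m a_ix_i\|\leq C\sum_1^m|a_i|$ for all real $(a_i)_1^m$. For $K\geq1$, $I(X,K)=\sup\{o(T):T\text{ is an }\ell_1\text{-}K\text{-tree on }X\}$, and the Bourgain $\ell_1$-index is $I(X)=\sup_{1\leq K<\infty}I(X,K)$.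 *)

(* Defs.v *)
From HB Require Import structures.
From mathcomp Require Import all_boot all_order all_algebra.
From mathcomp Require Import all_classical all_reals all_analysis.
Import Order.TTheory GRing.Theory Num.Theory.
Import numFieldNormedType.Exports.

Set Implicit Arguments.
Unset Strict Implicit.
Unset Printing Implicit Defensive.

Local Open Scope classical_set_scope.
Local Open Scope ring_scope.

(* Ordinals are represented by terms built from zero, successor and suprema of
   arbitrary non-empty families (the family need not be increasing, so a term
   osup is not necessarily a limit ordinal). Several terms denote the same
   ordinal: equality of ordinals is [oeq], not Leibniz equality. *)
Inductive ord : Type :=
| ozero
| osucc of ord
| osup (J : Type) (i0 : J) (f : J -> ord).

(* [below (ole a) b] is a < b, that is, a + 1 <= b. *)
Definition below (P : ord -> Prop) : ord -> Prop :=
  fix go (b : ord) : Prop :=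
    match b with
    | ozero => False
    | osucc b' => P b'
    | osup J _ f => exists i : J, go (f i)
    end.

Fixpoint ole (a b : ord) : Prop :=
  match a with
  | ozero => True
  | osucc a' => below (ole a') b
  | osup J _ f => forall i : J, ole (f i) b
  end.

Definition olt (a b : ord) : Prop := ole (osucc a) b.
Definition oeq (a b : ord) : Prop := ole a b /\ ole b a.
Definition olimit (a : ord) : Prop :=
  olt ozero a /\ forall b, olt b a -> olt (osucc b) a.

(* Supremum of a possibly empty family. *)
Definition olub (J : Type) (f : J -> ord) : ord :=
  osup None (fun o : option J => if o is Some i then f i else ozero).

(* Least ordinal satisfying P, with the junk value 0 if there is none. *)
Definition oinf (P : ord -> Prop) : ord :=
  match pselect (exists a, P a /\ forall b, P b -> ole a b) with
  | left h => projT1 (cid h)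
  | right _ => ozero
  end.

(* An ordinal is countable, i.e. smaller than omega_1, iff it has countably
   many predecessors. *)
Definition olt_omega1 (a : ord) : Prop :=
  exists s : nat -> ord, forall b, olt b a -> exists n, oeq b (s n).

Definition omega : ord := osup 0%N (fun n : nat => iter n osucc ozero).

Fixpoint oadd (a b : ord) : ord :=
  match b with
  | ozero => a
  | osucc b' => osucc (oadd a b')
  | osup J i0 f => osup i0 (fun i => oadd a (f i))
  end.

Fixpoint omul (a b : ord) : ord :=
  match b with
  | ozero => ozero
  | osucc b' => oadd (omul a b') a
  | osup J i0 f => osup i0 (fun i => omul a (f i))
  end.

Fixpoint omega_exp (b : ord) : ord :=
  match b with
  | ozero => osucc ozero
  | osucc b' => omul (omega_exp b') omega
  | osup J i0 f => osup i0 (fun i => omega_exp (f i))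
  end.

Section Trees.
Context (A : eqType) (le : rel A).

Definition predecessors (T : set A) (x : A) : set A :=
  [set y | T y /\ le y x && (y != x)].

Definition is_tree (T : set A) : Prop :=
  [/\ countable T, T !=set0,
      [/\ forall x, T x -> le x x,
          forall x y, T x -> T y -> le x y -> le y x -> x = y
        & forall x y z, T x -> T y -> T z -> le x y -> le y z -> le x z]
    & forall x, T x -> finite_set (predecessors T x) /\
        forall y z, predecessors T x y -> predecessors T x z ->
          le y z \/ le z y].

Definition tree_D (T : set A) : set A :=
  [set x | T x /\ exists2 y, T y & le x y && (x != y)].

(* On a limit ordinal the last clause agrees with the intersection over all
   smaller ordinals: see [deriv_limit]. *)
Fixpoint deriv (T : set A) (a : ord) : set A :=
  match a with
  | ozero => T
  | osucc b => tree_D (deriv T b)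
  | osup J _ f => [set x | forall i : J, deriv T (f i) x]
  end.

(* When T is not well-founded no derived set is empty, and this is the junk
   value 0. *)
Definition tree_order (T : set A) : ord := oinf (fun a => deriv T a = set0).

End Trees.

Section BanachSpaces.
Context (R : realType) (X : normedModType R).

Definition separable : Prop := exists2 A : set X, countable A & dense A.

Definition infinite_dimensional : Prop :=
  ~ exists (n : nat) (e : 'I_n -> X),
      forall x : X, exists a : 'I_n -> R, x = \sum_(i < n) a i *: e i.

Definition l1_summable (a : R^nat) : Prop := cvgn (series (fun n => `|a n|)).
Definition l1_norm (a : R^nat) : R := limn (series (fun n => `|a n|)).

(* U is used only on the space l_1 of absolutely summable sequences, on which
   it is an isomorphism onto a subspace of X. *)
Definition contains_l1 : Prop :=
  exists U : R^nat -> X,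
    (forall (s : R) (a b : R^nat), l1_summable a -> l1_summable b ->
       U (fun n => s * a n + b n) = s *: U a + U b) /\
    exists c C : R, [/\ 0 < c, 0 < C & forall a : R^nat, l1_summable a ->
       c * l1_norm a <= `|U a| <= C * l1_norm a].

Definition unit_sphere : set X := [set x | `|x| = 1].

Definition is_l1_tree (K : R) (T : set (seq X)) : Prop :=
  is_tree (@prefix X) T /\
  forall s : seq X, T s ->
    [/\ (0 < size s)%N, forall x, x \in s -> unit_sphere x &
      exists c C : R, [/\ 0 < c, 0 < C, c^-1 * C <= K &
        forall a : 'I_(size s) -> R,
          c * \sum_(i < size s) `|a i|
            <= `|\sum_(i < size s) a i *: s`_i|
            <= C * \sum_(i < size s) `|a i|]].

Definition l1_index_const (K : R) : ord :=
  olub (fun T : {T : seq X -> Prop | is_l1_tree K T} =>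
          tree_order (@prefix X) (sval T)).

Definition l1_index : ord :=
  olub (fun K : {K : R | 1 <= K} => l1_index_const (sval K)).

End BanachSpaces.

Lemma ole_osup a J (i0 : J) f i : ole a (f i) -> ole a (osup i0 f).
Proof.
by elim: a => //= [a _ h|J' j0 g ih h j]; [exists i|exact: ih].
Qed.

Lemma ole_succr a b : ole a b -> ole a (osucc b).
Proof.
elim: a b => //= [a ih b|J' j0 g ih b h j]; last exact: ih.
by elim: b => //= [b _ /ih //|J i0 f ihf [i /ihf]]; exact: ole_osup.
Qed.

Lemma ole_refl a : ole a a.
Proof. by elim: a => //= J i0 f ih i; exact: ole_osup (ih i). Qed.

Lemma ole_trans b a c : ole a b -> ole b c -> ole a c.
Proof.
elim: a b c => //= [a ih|J i0 f ih] b c; last by move=> h ? i; exact: ih (h i) _.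
elim: b c => //= [b _|J' j0 g ihg] c; last by move=> [j h] /(_ j); exact: ihg.
by move=> ab; elim: c => //= [c _ /(ih _ _ ab)|J' j0 g ihg [j /ihg]] //; exists j.
Qed.

Lemma ole_or_olt a b : ole a b \/ olt b a.
Proof.
rewrite /olt; elim: a b => [b|a ih b|J i0 f ih b] /=; first by left.
- elim: b => [|b _|J' j0 g ihg] /=; [by right|exact: ih|].
  have [|h] := pselect (exists j, below (ole a) (g j)); first by left.
  by right=> j; have [h'|//] := ihg j; case: h; exists j.
- have [|h] := pselect (exists i, below (ole b) (f i)); first by right.
  by left=> i; have [//|h'] := ih i b; case: h; exists i.
Qed.

Lemma olt_irr a : ~ olt a a.
Proof.
elim: a => [[]|a ih /ih//|J i0 f ih [i h]]; apply: (ih i).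
apply: (@ole_trans (osucc (osup i0 f)) _ _ _ h).
by apply: (@ole_osup _ _ i0 f i); exact: ole_refl.
Qed.

Lemma olt_wf : well_founded olt.
Proof.
suff h a : forall b, ole b a -> Acc olt b by move=> a; exact: h (ole_refl a).
elim: a => [|a ih|J i0 f ih] b ba; constructor => c cb.
- by have := ole_trans cb ba.
- exact/ih/(ole_trans cb ba : olt c (osucc a)).
- have [i ci] : olt c (osup i0 f) := ole_trans cb ba.
  by apply: (ih i); apply: (@ole_trans (osucc c) _ _ _ ci); exact/ole_succr/ole_refl.
Qed.

Lemma oinfP P : (exists a, P a) -> P (oinf P) /\ forall b, P b -> ole (oinf P) b.
Proof.
move=> [a Pa]; rewrite /oinf; case: pselect => [h|[]]; first by case: cid.
have [//|h] := pselect (exists a, P a /\ forall b, P b -> ole a b).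
exfalso; elim: (olt_wf a) Pa => {}a _ ih Pa; apply: h; exists a; split=> // b Pb.
by have [//|/ih] := ole_or_olt a b; case.
Qed.

Lemma deriv_anti (A : eqType) (le : rel A) (T : set A) a b :
  ole a b -> deriv le T b `<=` deriv le T a.
Proof.
have sub0 c : deriv le T c `<=` T.
  elim: c => [//|c ih x [/ih]//|J i0 f ih x /(_ i0)]; exact: ih.
elim: a b => [b _|a ih b|J i0 f ih b h x bx i]; first exact: sub0.
  elim: b => [[]|b _ /ih s x [/s ? [y /s Ty xy]]|J' j0 g ihg [j /ihg s] x].
    by split=> //; exists y.
  by move=> /(_ j)/s.
exact: (ih i b).
Qed.

Lemma deriv_limit (A : eqType) (le : rel A) (T : set A) a x : olimit a ->
  deriv le T a x <-> forall b, olt b a -> deriv le T b x.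
Proof.
move=> la; split=> [ax b ba|].
  apply: (deriv_anti _ ax); apply: (@ole_trans (osucc b) _ _ _ ba).
  exact/ole_succr/ole_refl.
elim: a la => [[[]]|a _ [_ /(_ a (ole_refl _))/olt_irr]|J i0 f ih [l0 lS] h i] //.
have fi : ole (f i) (osup i0 f) by apply: (@ole_osup _ _ i0 f i); exact: ole_refl.
have [le_fi|] := ole_or_olt (osup i0 f) (f i); last exact: h.
apply: (ih i) => [|b bf]; last by apply: h; exact: (@ole_trans (f i) (osucc b)).
split; first exact: (@ole_trans _ (osucc ozero) _ l0 le_fi).
move=> b bf; apply: (@ole_trans _ (osucc (osucc b)) _ _ le_fi).
by apply: lS; exact: (@ole_trans (f i) (osucc b)).
Qed.

(* Main.v *)
Require Import Defs.
From HB Require Import structures.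
From mathcomp Require Import all_boot all_order all_algebra.
From mathcomp Require Import all_classical all_reals all_analysis.
From mathcomp Require Import zify lra.
Import Order.TTheory GRing.Theory Num.Theory.
Import numFieldNormedType.Exports.

(** The index is the supremum of the ordinals [b] that are attained by [l1]
    trees, i.e. such that for some [K] one can, from the empty sequence, choose
    unit vectors along every descent from [b] to [0] so as to end with a finite
    sequence whose lower [l1] constant is [K] ([attained]). Precisely, [b] lies
    below the index iff [b + 1] is attained ([index_attained],
    [attained_index]). The trees of the definition are countable, but a tree of
    arbitrary unit vectors can be moved into a fixed dense sequence at the cost
    of a factor 2 in [K], because an error that is uniformly small in all
    coordinates is small compared with the [l1] norm of the coefficients. The
    resulting tree is countable and has no infinite branch, since such a branch
    would span a copy of [l1].

    The index is countable: an ordinal [b] below it is determined by an integer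
    [K] and a finite sequence in the dense sequence that survives exactly [b]
    derivations of the corresponding full tree ([l1_index_countable]).

    The main point is that [b + a] is attained when [a] and [b] are, provided
    that [m * b <= b] for all finite [m] ([attained_oadd]). At an end point [s] of
    a tree for [a], choose finitely many functionals, say [N], that norm the span
    of [s] up to a factor 2; vectors in their common kernel are then far from
    this span ([separating_functionals]). A tree for [b] contains a tree in this
    kernel: among [N + 1] successive vectors some nonzero combination is
    annihilated by the [N] functionals, and sequences of normalised combinations
    of disjoint blocks have the same lower [l1] constant. Merging [N + 1] steps
    into one costs a left factor [N + 1] in the order ([ext_blocks]), which [b]
    absorbs. The constant of the combined tree depends neither on [s] nor on [N].
    The norming functionals come from the Hahn-Banach theorem, proved here by
    minimising sublinear functionals.

    Finally let [W], a power of [omega], be the leading term of the index [I], so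
    that [W <= I < W * omega] ([leading_exponent]). As [X] is infinite-dimensional,
    all finite ordinals are attained and [omega <= I]; hence [W] is infinite and
    absorbs finite left factors. If [W < I], then [W * n] would be attained for
    all [n], whence [W * omega <= I], a contradiction. So [I = W]. *)

Set Implicit Arguments.
Unset Strict Implicit.
Unset Printing Implicit Defensive.

Local Open Scope classical_set_scope.
Local Open Scope ring_scope.

(** * Ordinal arithmetic *)

Lemma olt_ole a b : olt a b -> ole a b.
Proof. by apply: ole_trans; exact/ole_succr/ole_refl. Qed.

Lemma ole_osup_r J (i0 : J) f i : ole (f i) (osup i0 f).
Proof. exact/ole_osup/ole_refl. Qed.

Lemma ole_olub J (f : J -> ord) i : ole (f i) (olub f).
Proof.
exact: (@ole_osup_r _ None (fun o => if o is Some i then f i else ozero) (Some i)).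
Qed.

Lemma olt_olubP J (f : J -> ord) b : olt b (olub f) <-> exists i, olt b (f i).
Proof. by split=> [[[i h|[]]]|[i h]]; [exists i|exists (Some i)]. Qed.

Definition onat (n : nat) : ord := iter n osucc ozero.

Lemma onat_le_omega n : ole (onat n) omega.
Proof. exact: (@ole_osup_r _ 0%N onat n). Qed.

Lemma oaddA a b c : oadd a (oadd b c) = oadd (oadd a b) c.
Proof. by elim: c => //= [c ->|J i0 f ih] //; congr osup; exact/funext. Qed.

Lemma oadd0r a : oadd ozero a = a.
Proof. by elim: a => //= [a ->|J i0 f ih] //; congr osup; exact/funext. Qed.

Lemma oadd_onat m n : oadd (onat m) (onat n) = onat (m + n)%N.
Proof. by elim: n => [|n /= ->]; rewrite ?addn0 ?addnS. Qed.

Lemma omul_onat m n : omul (onat m) (onat n) = onat (m * n)%N.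
Proof. by elim: n => [|n /= ->]; rewrite ?muln0 // oadd_onat mulnS addnC. Qed.

Lemma omulDr a b c : omul a (oadd b c) = oadd (omul a b) (omul a c).
Proof.
by elim: c => //= [c ->|J i0 f ih]; rewrite -?oaddA//; congr osup; exact/funext.
Qed.

Lemma ole_oaddl a b : ole a (oadd a b).
Proof.
elim: b => /= [|b|J i0 f ih]; [exact: ole_refl|exact: ole_succr|].
exact: ole_osup (ih i0).
Qed.

Lemma oadd_mono_l a a' b : ole a a' -> ole (oadd a b) (oadd a' b).
Proof. by move=> h; elim: b => //= J i0 f ih i; exact: ole_osup (ih i). Qed.

Lemma oadd_mono_r a b b' : ole b b' -> ole (oadd a b) (oadd a b').
Proof.
elim: b b' => /= [b' _|b ih b'|J i0 f ih b' h i]; [exact: ole_oaddl| |exact: ih].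
by elim: b' => //= [b' _ /ih//|J i0 f ihf [i /ihf]]; exists i.
Qed.

Lemma omul_mono_l a a' b : ole a a' -> ole (omul a b) (omul a' b).
Proof.
move=> h; elim: b => //= [b ih|J i0 f ih i]; last exact: ole_osup (ih i).
exact: ole_trans (oadd_mono_l _ ih) (oadd_mono_r _ h).
Qed.

Lemma omul_mono_r a b b' : ole b b' -> ole (omul a b) (omul a b').
Proof.
elim: b b' => //= [b ih b'|J i0 f ih b' h i]; last exact: ih.
elim: b' => //= [b' _ /ih h|J i0 f ihf [i /ihf]]; first exact: oadd_mono_l.
exact: ole_osup.
Qed.

Lemma ole_omul_omega a n : ole (omul a (onat n)) (omul a omega).
Proof. exact/omul_mono_r/onat_le_omega. Qed.

Lemma omul_absorb a b c : ole (omul a b) b -> ole (omul a (omul b c)) (omul b c).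
Proof.
move=> h; elim: c => //= [c ih|J i0 f ih i]; last exact: ole_osup (ih i).
by rewrite omulDr; exact: ole_trans (oadd_mono_l _ ih) (oadd_mono_r _ h).
Qed.

Lemma omul_onat_omega m : ole (omul (onat m) omega) omega.
Proof. by move=> n; rewrite -/(onat n) omul_onat; exact: onat_le_omega. Qed.

Lemma omega_exp_gt0 a : ole (onat 1) (omega_exp a).
Proof.
elim: a => [|a ih|J i0 f ih]; [exact: ole_refl| |by exists i0; exact: (ih i0)].
apply: (ole_trans ih); apply: (ole_trans _ (ole_omul_omega _ 1)).
by rewrite /= oadd0r; exact: ole_refl.
Qed.

Lemma ole_omega_exp a : ole a (omega_exp a).
Proof.
elim: a => // [a ih|J i0 f ih i]; last exact: ole_osup (ih i).
apply: (ole_trans _ (ole_omul_omega _ 2)); rewrite /= oadd0r.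
exact: (ole_trans (ih : ole (osucc a) (oadd (omega_exp a) (onat 1))))
  (oadd_mono_r _ (omega_exp_gt0 a)).
Qed.

(** Left multiplication by a finite number leaves an infinite power of [omega]
    unchanged; this is what allows finitely many consecutive steps in a tree to
    be merged into one at no cost in order. *)
Lemma omega_exp_absorb a : ole (omega_exp a) (onat 1) \/
  (ole omega (omega_exp a) /\
   forall m, ole (omul (onat m) (omega_exp a)) (omega_exp a)).
Proof.
elim: a => [|a ih|J i0 f ih]; first by left.
- right; case: ih => [le1|[leo abs]]; last first.
    split=> [|m]; last exact: omul_absorb.
    apply: ole_trans leo (ole_trans _ (ole_omul_omega _ 1)).
    by rewrite /= oadd0r; exact: ole_refl.
  have le_o : ole omega (omega_exp (osucc a)).
    move=> n; apply: (ole_trans _ (ole_omul_omega _ n)).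
    apply: (ole_trans _ (omul_mono_l _ (omega_exp_gt0 a))).
    by rewrite omul_onat mul1n; exact: ole_refl.
  split; [exact: le_o|move=> m]; apply: (ole_trans _ le_o).
  apply: (ole_trans _ (omul_onat_omega m)); apply: omul_mono_r.
  apply: (ole_trans (omul_mono_l omega le1)).
  exact: omul_onat_omega 1%N.
- have [[i leo]|h] := pselect (exists i, ole omega (omega_exp (f i))); last first.
    by left=> i; case: (ih i) => // -[leo _]; case: h; exists i.
  have leo' : ole omega (omega_exp (osup i0 f)).
    exact: ole_trans leo (ole_osup_r i0 (fun i => omega_exp (f i)) i).
  right; split=> [|m j]; first exact: leo'.
   case: (ih j) => [le1|[_ /(_ m)]]; last first.
    exact: (@ole_osup _ _ i0 (fun i => omega_exp (f i))).
  apply: (ole_trans _ leo'); apply: ole_trans (omul_mono_r _ le1) _.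
  by rewrite omul_onat; exact: onat_le_omega.
Qed.

(** The leading term of the Cantor normal form. Exponents are tried in the
    order in which they are built, up to [osucc b], which is already too large. *)
Lemma leading_exponent b : ole (onat 1) b ->
  exists a, ole (omega_exp a) b /\ olt b (omega_exp (osucc a)).
Proof.
move=> b1; suff h c : ole (omega_exp c) b \/
    exists a, ole (omega_exp a) b /\ olt b (omega_exp (osucc a)).
  case: (h (osucc b)) => // le; case: (@olt_irr b).
  exact: ole_trans (ole_omega_exp (osucc b)) le.
elim: c => [|c [le|]|J i0 f ih]; [by left| |by right|].
- by have [|lt] := ole_or_olt (omega_exp (osucc c)) b; [left|right; exists c].
- have [?|h] := pselect (exists a, ole (omega_exp a) b /\ olt b (omega_exp (osucc a))).
    by right.
  by left=> i; case: (ih i).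
Qed.

(** * Extending a finite sequence [a] times *)

Section Extensions.
Context (X : Type).
Implicit Types (G : seq X -> Prop) (s t u : seq X).

(** [ext G a s]: from [s] one can choose further terms, one for each step of a
    descent from [a] to [0], and end in [G] however the descent is made. For
    prefix-closed [G] this says that [s] survives [a] derivations of the tree
    [G]; unlike [deriv] it is compositional in [a] (see [ext_oadd]). *)
Fixpoint ext G (a : ord) s : Prop :=
  match a with
  | ozero => G s
  | osucc b => exists x, ext G b (rcons s x)
  | osup J _ f => forall i : J, ext G (f i) s
  end.

Definition prefix_closed G := forall s x, G (rcons s x) -> G s.

Lemma ext_sub G G' a s : (forall t, G t -> G' t) -> ext G a s -> ext G' a s.
Proof.
move=> h; elim: a s => //= [a ih s [x /ih]|J i0 f ih s e i]; first by exists x.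
exact: ih.
Qed.

Lemma ext_map (h : X -> X) G G' a s : (forall t, G t -> G' (map h t)) ->
  ext G a s -> ext G' a (map h s).
Proof.
move=> hG; elim: a s => //= [a ih s [x /ih]|J i0 f ih s e i]; last exact: ih.
by rewrite map_rcons; exists (h x).
Qed.

Lemma ext_cat G G' a s t : (forall u, G u -> G' (s ++ u)) ->
  ext G a t -> ext G' a (s ++ t).
Proof.
move=> hG; elim: a t => //= [a ih t [x /ih]|J i0 f ih t e i]; last exact: ih.
by rewrite -rcons_cat; exists x.
Qed.

Lemma ext_oadd G b a s : ext G (oadd b a) s <-> ext (ext G b) a s.
Proof.
elim: a s => //= [a ih s|J i0 f ih s].
  by split=> -[x /ih]; exists x.
by split=> h i; apply/ih.
Qed.

Lemma ext_onat G n s : ext G (onat n) s -> exists u, size u = n /\ G (s ++ u).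
Proof.
elim: n s => [s h|n ih s [x /ih[u [un h]]]]; first by exists [::]; rewrite cats0.
by exists (x :: u); rewrite /= un -cat_rcons.
Qed.

Section PrefixClosed.
Context (G : seq X -> Prop) (Gc : prefix_closed G).

Lemma prefix_closed_cat s t : G (s ++ t) -> G s.
Proof.
elim/last_ind: t => [|t x ih]; first by rewrite cats0.
by rewrite -rcons_cat => /Gc.
Qed.

Lemma ext_base a s : ext G a s -> G s.
Proof. by elim: a s => //= [a ih s [x /ih/Gc]|J i0 f ih s /(_ i0)/ih]. Qed.

Lemma ext_closed a : prefix_closed (ext G a).
Proof.
elim: a => //= [a ih s x [y /ih h]|J i0 f ih s x h i]; first by exists x.
exact: ih (h i).
Qed.

Lemma ext_anti a b s : ole a b -> ext G b s -> ext G a s.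
Proof.
elim: a b s => [b s _|a ih b s|J i0 f ih b s h bs i]; [exact: ext_base| |].
  elim: b => //= [b _ h [x bx]|J i0 f ihf [i /ihf h] /(_ i)/h//].
  by exists x; exact: ih bx.
exact: ih (h i) bs.
Qed.

(** If every [a] is attained at [s], then so is every [a] at a single one-term
    extension: otherwise choose for each [x] an ordinal not attained after [x],
    and consider the successor of their supremum. *)
Lemma ext_all_step s : (forall a, ext G a s) -> exists x, forall a, ext G a (rcons s x).
Proof.
move=> h; apply: contrapT => /forallNP nx.
have /choice[f fP] x : exists a, ~ ext G a (rcons s x).
  by have /existsNP := nx x.
have [x ex] := h (osucc (olub f)); apply: (fP x).
exact: (@ext_anti _ (olub f) _ (ole_olub f x) ex).
Qed.

(** Otherwise [ext_all_step] produces an infinite branch of [G]. *)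
Lemma ext_bounded : (forall x : nat -> X, ~ forall n, G (mkseq x n)) ->
  exists a, ~ ext G a [::].
Proof.
move=> nG; apply/existsNP => h.
pose S := {s : seq X | forall a, ext G a s}.
have /choice[F FP] (s : S) : exists t : S, exists x, sval t = rcons (sval s) x.
  by have [x hx] := ext_all_step (svalP s); exists (exist _ _ hx), x.
pose s_ n := iter n F (exist _ [::] h : S).
have sS n : exists x, sval (s_ n.+1) = rcons (sval (s_ n)) x by exact: FP.
have ss n : size (sval (s_ n)) = n.
  by elim: n => // n ih; have [x ->] := sS n; rewrite size_rcons ih.
have [x0 _] := sS 0%N; apply: (nG (fun n => nth x0 (sval (s_ n.+1)) n)) => n.
rewrite (_ : mkseq _ _ = sval (s_ n)); first exact: ext_base (svalP (s_ n) ozero).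
elim: n => // n ih; have [x e] := sS n.
by rewrite mkseqS ih e nth_rcons ss ltnn eqxx.
Qed.

(** If every sequence attaining [b] also attained [osucc b], then by induction on
    [a] every one of them would attain every [a]. *)
Lemma ext_top a b : ~ ext G a [::] -> ext G b [::] ->
  exists s, ext G b s /\ ~ ext G (osucc b) s.
Proof.
move=> na b0; apply: contrapT => /forallNP h.
have {}h s : ext G b s -> ext G (osucc b) s.
  by move=> bs; apply: contrapT => ns; apply: (h s).
apply: na; elim: a [::] b0 => [s|a ih s /h[x /ih]|J i0 f ih s bs i]; [exact: ext_base| |].
  by exists x.
exact: ih.
Qed.

End PrefixClosed.
End Extensions.

Section Trees.
Context (X : eqType).
Implicit Types (G : seq X -> Prop) (T : set (seq X)) (s t : seq X).

Definition full_tree G : set (seq X) := [set s | s <> [::] /\ G s].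

Lemma deriv_full_tree G a s : prefix_closed G ->
  Defs.deriv (@prefix X) (full_tree G) a s <-> s <> [::] /\ ext G a s.
Proof.
move=> Gc; elim: a s => [s|a ih s|J i0 f ih s] //=.
- rewrite /tree_D /=; split=> [[/ih[s0 _]]|[s0 [x sx]]].
    move=> [y /ih[_ ya] /andP[/prefixP[[|x u] e] ne]].
      by move: ne; rewrite e cats0 eqxx.
    split=> //; exists x; apply: (@prefix_closed_cat _ _ (ext_closed Gc (a := a)) _ u).
    by rewrite cat_rcons -e.
  split; first by apply/ih; split=> //; exact: (ext_closed Gc) sx.
  exists (rcons s x); first by apply/ih; split=> //; case: (s).
  rewrite prefix_rcons/=; apply/negP => /eqP/(congr1 size)/eqP.
  by rewrite size_rcons ltn_eqF.
- split=> [h|[s0 h] i]; last by apply/ih; split.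
  by split=> [|i]; [have /ih[] := h i0|have /ih[] := h i].
Qed.

Lemma deriv_sub T T' a : T `<=` T' ->
  Defs.deriv (@prefix X) T a `<=` Defs.deriv (@prefix X) T' a.
Proof.
move=> TT'; elim: a => //= [a ih s [/ih s' [t /ih t' st]]|J i0 f ih s h i].
  by split=> //; exists t.
exact: ih.
Qed.

Lemma prefix_of_prefix s t u : prefix t s -> prefix u s ->
  (size t <= size u)%N -> prefix t u.
Proof. by rewrite !prefixE => /eqP et /eqP eu tu; rewrite -eu take_takel ?et. Qed.

Lemma full_tree_is_tree G : countable [set s | G s] -> full_tree G !=set0 ->
  is_tree (@prefix X) (full_tree G).
Proof.
move=> Gcount ne; split=> //.
- by apply: sub_countable Gcount; apply: subset_card_le => s [].
- split=> [s _|s t _ _|s t u _ _ _]; [exact: prefix_refl| |exact: prefix_trans].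
  move=> /prefixP[u ->] /prefixP[v /(congr1 size)]; rewrite !size_cat.
  by case: u => [|x u /= h]; [rewrite cats0|exfalso; move: h; lia].
- move=> s _; split.
    apply: (@sub_finite_set _ _ [set` [seq take n s | n <- iota 0 (size s + 1)]]).
      move=> t [_ /andP[/prefixP[u e] _]] /=; apply/mapP; exists (size t).
        by rewrite mem_iota e size_cat; lia.
      by rewrite e take_size_cat.
    exact: finite_seq.
  move=> t u [_ /andP[ts _]] [_ /andP[us _]].
  by have [tu|/ltnW ut] := leqP (size t) (size u); [left|right];
    exact: (@prefix_of_prefix s).
Qed.

End Trees.

(** * Norming functionals *)

Section HahnBanach.
Context (R : realType) (X : normedModType R).
Implicit Types (p q : X -> R) (x y g : X).

Definition sublinear q := (forall x y, q (x + y) <= q x + q y) /\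
  (forall t x, 0 < t -> q (t *: x) <= t * q x).

Lemma sublinearZ q t x : sublinear q -> 0 < t -> q (t *: x) = t * q x.
Proof.
move=> [_ qZ] t0; apply/eqP; rewrite eq_le qZ//=.
have ti : 0 < t^-1 by rewrite invr_gt0.
have := qZ _ (t *: x) ti.
by rewrite scalerA mulVf ?gt_eqF// scale1r ler_pdivlMl.
Qed.

Lemma sublinear0 q : sublinear q -> q 0 = 0.
Proof.
move=> sq; have := @sublinearZ q 2 0 sq (ltr0n _ 2).
by rewrite scaler0 => h; lra.
Qed.

Lemma sublinearN_ge q x : sublinear q -> - q (- x) <= q x.
Proof.
move=> sq; have := sq.1 x (- x); rewrite subrr sublinear0// => h; lra.
Qed.

(** For sublinear [q] this is the largest sublinear minorant of [q] whose value at
    [- g] is at most [- q g]. *)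
Definition descend q g x := inf [set q (x + t *: g) - t * q g | t in [set t | 0 <= t]].

Section Descend.
Context (q : X -> R) (g : X) (sq : sublinear q).

Let vals x := [set q (x + t *: g) - t * q g | t in [set t | 0 <= t]].

Let vals_lb x : lbound (vals x) (- q (- x)).
Proof.
move=> _ [t /= t0 <-]; have : q (t *: g) <= q (x + t *: g) + q (- x).
  by rewrite {1}(_ : t *: g = (x + t *: g) + - x) ?sq.1// addrAC subrr add0r.
suff -> : q (t *: g) = t * q g by move=> h; lra.
move: t0; rewrite le_eqVlt => /predU1P[<-|/sublinearZ->//].
by rewrite scale0r mul0r sublinear0.
Qed.

Lemma descend_le x t : 0 <= t -> descend q g x <= q (x + t *: g) - t * q g.
Proof.
by move=> t0; apply: ge_inf; [exists (- q (- x)); exact: vals_lb|exists t].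
Qed.

Lemma le_descend x b : (forall t, 0 <= t -> b <= q (x + t *: g) - t * q g) ->
  b <= descend q g x.
Proof.
move=> h; apply: lb_le_inf => [|_ [t /= t0 <-]]; last exact: h.
by exists (q (x + 0 *: g) - 0 * q g); exists 0 => //=.
Qed.

Lemma descend_sublinear : sublinear (descend q g).
Proof.
split=> [x y|c x c0].
  rewrite -lerBlDr; apply: le_descend => t t0.
  rewrite lerBlDr [leRHS]addrC -lerBlDr; apply: le_descend => u u0.
  rewrite lerBlDr; apply: le_trans (descend_le _ (addr_ge0 t0 u0)) _.
  have := sq.1 (x + t *: g) (y + u *: g).
  by rewrite addrACA -scalerDl => h; lra.
rewrite -ler_pdivrMl//; apply: le_descend => t t0; rewrite ler_pdivrMl//.
apply: le_trans (descend_le _ (mulr_ge0 (ltW c0) t0)) _.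
by rewrite -scalerA -scalerDr sublinearZ// -mulrA -mulrBr.
Qed.

Lemma descend_minorant x : descend q g x <= q x.
Proof. by have := descend_le x (lexx 0); rewrite scale0r mul0r addr0 subr0. Qed.

Lemma descendN : descend q g (- g) <= - q g.
Proof.
have := descend_le (- g) ler01; rewrite scale1r addNr sublinear0// mul1r.
by rewrite sub0r.
Qed.

Lemma descend_shift x : descend q g x <= q (x + g) - q g.
Proof. by have := descend_le x ler01; rewrite scale1r mul1r. Qed.

End Descend.

(** By Zorn's lemma: the infimum of a chain of sublinear functionals is again
    sublinear, and it is finite because a sublinear [q] below [p] satisfies
    [- p (- x) <= q x]. *)
Lemma minimal_sublinear p : sublinear p -> exists q, [/\ sublinear q,
  forall x, q x <= p x & forall r, sublinear r -> (forall x, r x <= q x) -> r = q].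
Proof.
move=> sp; pose T := {q : X -> R | sublinear q /\ forall x, q x <= p x}.
pose ge_ (a b : T) := `[< forall x, sval b x <= sval a x >].
have [||||m mP] := @Zorn T ge_.
- by move=> a; apply/asboolP => x.
- move=> a b c /asboolP ab /asboolP bc; apply/asboolP => x.
  exact: le_trans (bc x) (ab x).
- move=> [a Pa] [b Pb] /asboolP/= ab /asboolP/= ba; apply/eq_exist/funext => x.
  by apply/eqP; rewrite eq_le ab ba.
- move=> A tot; have [[a0 Aa0]|/set0P/negP/negPn/eqP ->] := pselect (A !=set0); last first.
    by have hp : sublinear p /\ (forall x, p x <= p x) by []; exists (exist _ p hp).
  pose V x := [set sval a x | a in A]; pose q x := inf (V x).
  have V_lb x a : A a -> q x <= sval a x.
    move=> Aa; apply: ge_inf; last by exists a.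
    exists (- p (- x)) => _ [b Ab <-]; have [sb bp] := svalP b.
    by apply: le_trans (sublinearN_ge x sb); rewrite lerN2.
  have q_ge x b : (forall a, A a -> b <= sval a x) -> b <= q x.
    move=> h; apply: lb_le_inf => [|_ [a Aa <-]]; last exact: h.
    by exists (sval a0 x); exists a0.
  have sq : sublinear q.
    split=> [x y|t x t0].
      rewrite -lerBlDr; apply: (q_ge) => a Aa; rewrite lerBlDr [leRHS]addrC -lerBlDr.
      apply: (q_ge) => b Ab; rewrite lerBlDr.
      have [/asboolP ab|/asboolP ba] := tot a b Aa Ab.
        apply: le_trans (V_lb _ _ Ab) _; apply: le_trans ((svalP b).1.1 x y) _.
        by rewrite [leRHS]addrC lerD2r ab.
      apply: le_trans (V_lb _ _ Aa) _; apply: le_trans ((svalP a).1.1 x y) _.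
      by rewrite [leRHS]addrC lerD2l ba.
    rewrite -ler_pdivrMl//; apply: (q_ge) => a Aa; rewrite ler_pdivrMl//.
    exact: le_trans (V_lb _ _ Aa) ((svalP a).1.2 t x t0).
  have qp x : q x <= p x by exact: le_trans (V_lb x _ Aa0) ((svalP a0).2 x).
  exists (exist _ q (conj sq qp)) => a Aa; apply/asboolP => x; exact: V_lb.
- have [sm mp] := svalP m; exists (sval m); split=> // r sr rm.
  have hr : sublinear r /\ forall x, r x <= p x.
    by split=> // x; exact: le_trans (rm x) (mp x).
  have := mP (exist _ r hr); rewrite /ge_ => /(_ (asboolT rm)) e.
  by rewrite -e.
Qed.

(** A minimal sublinear functional is linear, since it coincides with each of
    its minorants [descend q g]. Starting from [descend] of the norm at [g]
    makes the linear functional attain its norm at [g]. *)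
Lemma norming_functional g : exists f : {scalar X},
  (forall x, f x <= `|x|) /\ f g = `|g|.
Proof.
pose N x : R := `|x|.
have sN : sublinear N.
  by split=> [x y|t x t0]; [exact: ler_normD|rewrite /N normrZ gtr0_norm].
have [q [sq qN qmin]] := minimal_sublinear (descend_sublinear g sN).
have qD x y : q (x + y) = q x + q y.
  apply/eqP; rewrite eq_le sq.1/=.
  have e := qmin _ (descend_sublinear y sq) (descend_minorant y sq).
  have := descend_shift y sq x; rewrite e => h; lra.
have qNx x : q (- x) = - q x.
  by have := qD x (- x); rewrite subrr sublinear0// => h; lra.
have qZ t x : q (t *: x) = t * q x.
  have [t0|t0|->] := ltgtP t 0; last by rewrite scale0r mul0r sublinear0.
    rewrite -[t]opprK scaleNr qNx sublinearZ ?oppr_gt0//; lra.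
  exact: sublinearZ.
have ql : scalar q by move=> t x y; rewrite qD qZ.
pose f : {scalar X} := HB.pack q (GRing.isLinear.Build R X R _ q ql).
have fN x : f x <= `|x| by exact: le_trans (qN x) (descend_minorant g sN x).
exists f; split=> //; apply/eqP; rewrite eq_le fN/=.
have := le_trans (qN (- g)) (descendN g sN); rewrite qNx lerN2; exact.
Qed.

End HahnBanach.

(** * Finite [l1] sequences *)

Section Combinations.
Context (R : realType) (X : normedModType R).
Implicit Types (a b c : nat -> R) (s t u : seq X) (x y : X) (K L : R).

(** Coefficients are functions on [nat] of which only the first [size s] (resp.
    [n]) values matter, so that sequences can be split and concatenated without
    any change of type. *)
Definition lc a s : X := \sum_(i < size s) a i *: s`_i.
Definition l1 a (n : nat) : R := \sum_(i < n) `|a i|.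

Definition catc (n : nat) a b : nat -> R :=
  fun i => if (i < n)%N then a i else b (i - n)%N.

Lemma lc_nil a : lc a [::] = 0. Proof. by rewrite /lc big_ord0. Qed.

Lemma eq_lc a b s : (forall i, (i < size s)%N -> a i = b i) -> lc a s = lc b s.
Proof. by move=> h; apply: eq_bigr => i _; rewrite h. Qed.

Lemma lc_cat a s t : lc a (s ++ t) = lc a s + lc (fun i => a (size s + i)%N) t.
Proof.
rewrite /lc size_cat big_split_ord/=; congr (_ + _); apply: eq_bigr => i _.
  by rewrite nth_cat ltn_ord.
by rewrite nth_cat ltnNge leq_addr/= addKn.
Qed.

Lemma lc_catc a b s t : lc (catc (size s) a b) (s ++ t) = lc a s + lc b t.
Proof.
rewrite lc_cat; congr (_ + _); apply: eq_lc => i; rewrite /catc; first by move->.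
by move=> _; rewrite ltnNge leq_addr/= addKn.
Qed.

Lemma lc_rcons a s x : lc a (rcons s x) = lc a s + a (size s) *: x.
Proof. by rewrite -cats1 lc_cat {2}/lc big_ord1 addn0. Qed.

Lemma lc_cons a s x : lc a (x :: s) = a 0%N *: x + lc (fun i => a i.+1) s.
Proof. by rewrite /lc big_ord_recl. Qed.

Lemma lcZ k a s : lc (fun i => k * a i) s = k *: lc a s.
Proof. by rewrite /lc scaler_sumr; apply: eq_bigr => i _; rewrite scalerA. Qed.

Lemma lcB a b s : lc (fun i => a i - b i) s = lc a s - lc b s.
Proof. by rewrite /lc -sumrB; apply: eq_bigr => i _; rewrite scalerBl. Qed.

Lemma l1_ge0 a n : 0 <= l1 a n. Proof. exact: sumr_ge0. Qed.

Lemma l1D a n m : l1 a (n + m) = l1 a n + l1 (fun i => a (n + i)%N) m.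
Proof. by rewrite /l1 big_split_ord. Qed.

Lemma eq_l1 a b n : (forall i, (i < n)%N -> a i = b i) -> l1 a n = l1 b n.
Proof. by move=> h; apply: eq_bigr => i _; rewrite h. Qed.

Lemma l1_catc a b n m : l1 (catc n a b) (n + m) = l1 a n + l1 b m.
Proof.
rewrite l1D; congr (_ + _); apply: eq_l1 => i; rewrite /catc; first by move->.
by move=> _; rewrite ltnNge leq_addr/= addKn.
Qed.

Lemma l1Z k a n : l1 (fun i => k * a i) n = `|k| * l1 a n.
Proof. by rewrite /l1 mulr_sumr; apply: eq_bigr => i _; rewrite normrM. Qed.

Lemma l1_0 n : l1 (fun=> 0) n = 0.
Proof. by apply: big1 => i _; rewrite normr0. Qed.

Lemma lc0 s : lc (fun=> 0) s = 0.
Proof. by apply: big1 => i _; rewrite scale0r. Qed.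

Definition units s := forall x, x \in s -> `|x| = 1.

Lemma norm_lc a s : units s -> `|lc a s| <= l1 a (size s).
Proof.
move=> us; apply: le_trans (ler_norm_sum _ _ _) _; apply: ler_sum => i _.
by rewrite normrZ us ?mulr1// mem_nth.
Qed.

(** For unit vectors the upper [l1] estimate holds with constant 1, so that the
    constant of the lower estimate measures the distortion. *)
Definition l1seq K s := units s /\ forall a, l1 a (size s) <= K * `|lc a s|.

Lemma l1seq_nil K : l1seq K [::].
Proof. by split=> // a; rewrite lc_nil normr0 mulr0 /l1 big_ord0. Qed.

Lemma l1seq_closed K : prefix_closed (l1seq K).
Proof.
move=> s x [us h]; split=> [y ys|a]; first by apply: us; rewrite mem_rcons inE ys orbT.
have := h (catc (size s) a (fun=> 0)); rewrite -cats1 lc_catc size_cat l1_catc.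
by rewrite lc0 l1_0 !addr0.
Qed.

Lemma l1seq_suffix K s t : l1seq K (s ++ t) -> l1seq K t.
Proof.
move=> [us h]; split=> [y yt|a]; first by apply: us; rewrite mem_cat yt orbT.
have := h (catc (size s) (fun=> 0) a); rewrite lc_catc size_cat l1_catc.
by rewrite lc0 l1_0 !add0r.
Qed.

Lemma l1seq_le K L s : K <= L -> l1seq K s -> l1seq L s.
Proof.
move=> KL [us h]; split=> // a; apply: le_trans (h a) _.
exact: ler_wpM2r.
Qed.

(** A uniform displacement of the vectors by [(2 * K)^-1], however long the
    sequence, absorbs only half of the lower estimate. *)
Lemma l1seq_perturb K s (h : X -> X) : 1 <= K ->
  (forall x, `|x| = 1 -> `|h x| = 1 /\ `|x - h x| <= (2 * K)^-1) ->
  l1seq K s -> l1seq (2 * K) (map h s).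
Proof.
move=> K1 hh [us hs]; have K0 : 0 < K by lra.
split=> [_ /mapP[x xs ->]|a]; first by have [] := hh x (us x xs).
have d : `|lc a s - lc a (map h s)| <= (2 * K)^-1 * l1 a (size s).
  rewrite /lc size_map -sumrB; apply: le_trans (ler_norm_sum _ _ _) _.
  rewrite /l1 mulr_sumr; apply: ler_sum => i _.
  rewrite (nth_map 0)// -scalerBr normrZ mulrC ler_wpM2r//.
  by have [] := hh _ (us _ (mem_nth 0 (ltn_ord i))).
have K2 : 0 < 2 * K by lra.
move: d; rewrite ler_pdivlMl// size_map => d.
have := ler_normD (lc a s - lc a (map h s)) (lc a (map h s)); rewrite subrK => tr.
have := hs a; nra.
Qed.

Section Functionals.
Implicit Types (f : nat -> {scalar X}) (N : nat).

Definition annihilated f N y := forall i, (i < N)%N -> f i y = 0.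

Lemma scalar_lc (f : {scalar X}) a s : f (lc a s) = \sum_(i < size s) a i * f s`_i.
Proof. by rewrite /lc linear_sum; apply: eq_bigr => i _; rewrite linearZ. Qed.

Lemma annihilated_lc f N a s :
  (forall y, y \in s -> annihilated f N y) -> annihilated f N (lc a s).
Proof.
move=> h i iN; rewrite scalar_lc big1// => j _; rewrite (h s`_j)// ?mulr0//.
exact: mem_nth.
Qed.

Lemma annihilatedZ f N k y : annihilated f N y -> annihilated f N (k *: y).
Proof. by move=> h i iN; rewrite linearZ/= h// mulr0. Qed.

(** The net is the grid of mesh [d] in the cube that contains the ball; an error
    of [d] in each of the [n] coordinates adds up to at most [e]. *)
Lemma l1_ball_net (n : nat) (e : R) : 0 < e -> exists (N : nat) (g : nat -> nat -> R),
  forall a, l1 a n <= 1 -> exists2 k, (k < N)%N & l1 (fun i => a i - g k i) n <= e.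
Proof.
move=> e0; pose d := e / n.+1%:R; have d0 : 0 < d by rewrite divr_gt0.
pose M := Num.truncn (2 / d); pose F := {ffun 'I_n -> 'I_M.+1}.
pose g k i : R := if (insub k : option 'I_#|F|) is Some o then
  if (insub i : option 'I_n) is Some j then (@enum_val F F o j)%:R * d - 1 else 0 else 0.
exists #|F|, g => a a1.
pose m i := Num.truncn ((a i + 1) / d).
exists (enum_rank [ffun i : 'I_n => inord (m i) : 'I_M.+1]) => //.
apply: (@le_trans _ _ (\sum_(i < n) d)); last first.
  rewrite sumr_const card_ord -mulr_natr /d -mulrA.
  by rewrite ger_pMr// mulrC ler_pdivrMr// mul1r ler_nat.
apply: ler_sum => i _; rewrite /g !valK enum_rankK ffunE.
have ai : `|a i| <= 1.
  apply: le_trans a1; rewrite /l1 (bigD1 i)//= lerDl; exact: sumr_ge0.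
move: ai; rewrite ler_norml => /andP[ai1 ai2].
have q0 : 0 <= (a i + 1) / d by rewrite divr_ge0 ?(ltW d0)//; lra.
have /andP[m1 m2] := truncn_itv q0.
have mM : (m i < M.+1)%N.
  rewrite ltnS; apply: le_truncn; rewrite ler_pM2r ?invr_gt0//; lra.
rewrite inordK//; move: m1 m2; rewrite ler_pdivlMr// ltr_pdivrMr// -/(m i) -natr1.
by move=> m1 m2; rewrite ler_norml; apply/andP; split; lra.
Qed.

(** Finitely many functionals norm the span of [s] up to the factor 1/2: take
    functionals norming the combinations with coefficients in a fine net of the
    [l1] ball. On their common kernel the distance to this span is controlled,
    with a constant that does not depend on [s]. *)
Lemma separating_functionals K s : 0 < K -> l1seq K s -> exists f N,
  forall y, annihilated f N y -> forall a, l1 a (size s) <= 2 * K * `|lc a s + y|.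
Proof.
move=> K0 [us hs]; have e0 : 0 < (4 * K)^-1 by rewrite invr_gt0; lra.
have [N [g gP]] := l1_ball_net (size s) e0.
have /choice[f fP] k := norming_functional (lc (g k) s).
exists f, N => y yN a; have [a0|a0] := eqVneq (l1 a (size s)) 0.
  by rewrite a0; apply: mulr_ge0 => //; lra.
have A0 : 0 < l1 a (size s) by rewrite lt_neqAle eq_sym a0 l1_ge0.
set A := l1 a (size s) in A0 *; pose a' i := A^-1 * a i.
have a'1 : l1 a' (size s) = 1 by rewrite l1Z gtr0_norm ?invr_gt0// mulVf ?gt_eqF.
(* The net error [(4 * K)^-1] enters twice, once for the norm of [w] and once
   for the value of its norming functional; the rest is [K^-1 / 2]. *)
have [|k kN dk] := gP a'; first by rewrite a'1.
set z := lc a' s; set w := lc (g k) s in fP.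
have ea : lc a s + y = A *: (z + A^-1 *: y).
  by rewrite scalerDr scalerA mulfV// scale1r /z lcZ scalerA mulfV// scale1r.
have zw : `|z - w| <= (4 * K)^-1.
  by rewrite /z /w -lcB; apply: le_trans dk; exact: norm_lc.
have hz : 1 <= K * `|z| by rewrite -a'1; exact: hs.
have [fN fw] := fP k.
have f1 : f k (z - w) >= - `|z - w|.
  by rewrite lerNl -linearN -normrN; exact: fN.
have f2 : f k z <= `|z + A^-1 *: y|.
  by have := fN (z + A^-1 *: y); rewrite linearD linearZ/= yN// mulr0 addr0.
have wz : `|z| <= `|w| + `|z - w| by rewrite -lerBlDl lerB_dist.
move: f1; rewrite linearB/= fw => f1.
rewrite ea normrZ gtr0_norm// mulrCA ler_peMr ?(ltW A0)//.
have K4 : K * (4 * K)^-1 = 4^-1 by rewrite invfM mulrCA mulfV ?mulr1// gt_eqF.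
have h : `|z| - 2 * (4 * K)^-1 <= `|z + A^-1 *: y|.
  by move: zw f1 f2 wz; set e := _^-1; lra.
have := ler_wpM2l (ltW K0) h; rewrite mulrBr mulrCA K4; lra.
Qed.

End Functionals.
End Combinations.
(** * Adding up trees *)

Section Blocks.
Context (R : realType) (X : normedModType R).
Implicit Types (s t u : seq X) (x y : X) (K L : R).
Implicit Types (f : nat -> {scalar X}) (N : nat).

(** If only zero were annihilated, then [X] would be spanned by [N] vectors: each
    functional, when dropped, enlarges the common kernel by at most one dimension. *)
Lemma unit_annihilated f N : infinite_dimensional X ->
  exists y, `|y| = 1 /\ annihilated f N y.
Proof.
move=> infX; apply: contrapT => /forallNP none.
have triv y : annihilated f N y -> y = 0.
  move=> hy; apply/eqP/negPn/negP => y0; apply: (none (`|y|^-1 *: y)).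
  split; last exact: annihilatedZ.
  by rewrite normrZ normfV normr_id mulVf ?normr_eq0.
have span n : (forall e : seq X,
    (forall y, annihilated f n y -> exists a, y = lc a e) ->
    exists e' : seq X, forall y, exists a, y = lc a e').
  elim: n => [|n ih] e he; first by exists e => y; exact: he.
  have [[z [hz fz]]|h] := pselect (exists z, annihilated f n z /\ f n z != 0).
    apply: (ih (z :: e)) => y hy.
    have [|a ea] := he (y - (f n y / f n z) *: z).
      move=> i; rewrite ltnS leq_eqVlt linearB linearZ/= => /predU1P[->|i_n].
        by rewrite divfK// subrr.
      by rewrite (hz i)// (hy i)// mulr0 subr0.
    exists (fun i => if i is j.+1 then a j else f n y / f n z).
    by rewrite lc_cons -ea addrC subrK.
  apply: (ih e) => y hy; apply: he => i.
  rewrite ltnS leq_eqVlt => /predU1P[->|]; last exact: hy.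
  by apply/eqP/negPn/negP => fy; apply: h; exists y.
have [|e he] := span N [::].
  by move=> y /triv ->; exists (fun=> 0); rewrite lc_nil.
apply: infX; exists (size e), (fun i => e`_i) => x.
by have [a ->] := he x; exists (fun i => a i).
Qed.

Lemma annihilated_combination f N u : size u = N.+1 ->
  exists c, 0 < l1 c N.+1 /\ annihilated f N (lc c u).
Proof.
move=> un; pose A := \matrix_(i < N.+1, j < N) f j u`_i.
have : kermx A != 0.
  rewrite kermx_eq0 /row_free; apply/negP => /eqP h.
  by have := rank_leq_col A; rewrite h ltnn.
move=> /rowV0Pn[v /sub_kermxP vA v0]; exists (fun i => v 0 (inord i)); split.
  rewrite lt_neqAle l1_ge0 andbT eq_sym; apply: contra v0 => /eqP h.
  apply/eqP/rowP => i; rewrite mxE; apply/eqP; rewrite -normr_eq0 -[i]inord_val.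
  by rewrite (psumr_eq0P (fun j _ => normr_ge0 (v 0 (inord (j : 'I_N.+1)))) h).
move=> j jN; rewrite scalar_lc un; have := congr1 (fun M : 'rV__ => M 0 (Ordinal jN)) vA.
rewrite !mxE => h; rewrite -[RHS]h; apply: eq_bigr => i _.
by rewrite inord_val mxE.
Qed.

(** What is needed of a sequence [t] of normalised combinations of consecutive
    blocks of [s], taken in the kernel: the last clause transfers lower [l1]
    estimates from [s] to [t] without loss in the constant. *)
Definition blocks f N s t := [/\ units t, forall y, y \in t -> annihilated f N y &
  forall b, exists a, lc b t = lc a s /\ l1 b (size t) <= l1 a (size s)].

Lemma blocks_nil f N : blocks f N [::] [::].
Proof. by split=> // b; exists b. Qed.

(** A unit vector that is a combination of unit vectors has coefficients of total
    size at least 1, whence the last clause of [blocks] for the extended sequence. *)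
Lemma blocks_step f N K s t u : l1seq K (s ++ u) -> size u = N.+1 ->
  blocks f N s t -> exists y, blocks f N (s ++ u) (rcons t y).
Proof.
move=> su un [ut ft bt]; have [uu hu] := l1seq_suffix su.
have [c [c0 fc]] := annihilated_combination f un.
have z0 : 0 < `|lc c u|.
  rewrite lt_neqAle normr_ge0 andbT eq_sym; apply/negP => /eqP e.
  by have := hu c; rewrite e mulr0 un leNgt c0.
exists (`|lc c u|^-1 *: lc c u); split.
- move=> y; rewrite mem_rcons inE => /predU1P[->|/ut//].
  by rewrite normrZ normfV normr_id mulVf ?gt_eqF.
- by move=> y; rewrite mem_rcons inE => /predU1P[->|/ft//]; exact: annihilatedZ.
- move=> b; have [a [ea la]] := bt b; pose k := b (size t) / `|lc c u|.
  exists (catc (size s) a (fun i => k * c i)); split.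
    by rewrite lc_rcons lc_catc lcZ ea scalerA.
  rewrite size_rcons size_cat l1_catc l1Z -addn1 l1D; apply: lerD => //.
  rewrite /l1 big_ord1 addn0 -/(l1 _ _) /k normrM normfV normr_id -mulrA.
  rewrite ler_peMr// ler_pdivlMl// mulr1; exact: norm_lc.
Qed.

(** Merging [N.+1] consecutive steps into one: among [N.+1] independent vectors
    some combination is killed by [N] functionals. *)
Lemma ext_blocks f N K b s t : blocks f N s t ->
  ext (l1seq K) (omul (onat N.+1) b) s ->
  ext (fun t => l1seq K t /\ forall y, y \in t -> annihilated f N y) b t.
Proof.
elim: b s t => [|b ih|J i0 g ih] s t st.
- move=> [us hs]; have [ut ft bt] := st; split=> //; split=> // b.
  by have [a [-> la]] := bt b; exact: le_trans la (hs a).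
- move=> /(ext_oadd (l1seq K) (omul (onat N.+1) b) (onat N.+1)) /ext_onat[u [un hu]].
  have [y bl] := blocks_step (ext_base (@l1seq_closed _ _ K) hu) un st.
  by exists y; exact: ih bl hu.
- by move=> h i; exact: ih st (h i).
Qed.

(** The factor depends on the constants of [s] and [t] only, not on [s], [t] or
    the functionals; this is why trees glued at all end points of a tree form an
    [l1] tree. *)
Definition glue_const K L := 2 * K + L * (1 + 2 * K).

Lemma l1seq_glue f N K L s t : 0 < K -> 0 < L -> units s ->
  (forall y, annihilated f N y -> forall a, l1 a (size s) <= 2 * K * `|lc a s + y|) ->
  l1seq L t -> (forall y, y \in t -> annihilated f N y) ->
  l1seq (glue_const K L) (s ++ t).
Proof.
move=> K0 L0 us sep [ut ht] ft; split=> [x|c].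
  by rewrite mem_cat => /orP[/us|/ut].
rewrite size_cat l1D lc_cat; set b := fun i => _.
have h1 := sep _ (annihilated_lc b ft) c; have h2 := ht b.
have h3 := norm_lc c us.
have h4 := ler_normB (lc c s + lc b t) (lc c s).
rewrite addrAC subrr add0r in h4.
have := ler_wpM2l (ltW L0) (le_trans h4 (lerD (lexx _) (le_trans h3 h1))).
rewrite /glue_const => h5; lra.
Qed.

Definition attained (b : ord) := exists K, 1 <= K /\ ext (@l1seq R X K) b [::].

Lemma attained_le a b : ole a b -> attained b -> attained a.
Proof.
move=> ab [K [K1 h]]; exists K; split=> //.
exact: ext_anti (@l1seq_closed _ _ K) _ _ _ ab h.
Qed.

(** At each end point [s] of a tree of order [a] one places a tree of order [b]
    inside the kernel of functionals norming the span of [s]. Merging steps so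
    as to get into the kernel does not reduce the order [b]. *)
Lemma attained_oadd a b : (forall m, ole (omul (onat m) b) b) ->
  attained a -> attained b -> attained (oadd b a).
Proof.
move=> bb [K [K1 ha]] [L [L1 hb]]; exists (glue_const K L); split.
  rewrite /glue_const; nra.
apply/ext_oadd; apply: ext_sub ha => s ls.
have K0 : 0 < K by lra.
have L0 : 0 < L by lra.
have [f [N sep]] := separating_functionals K0 ls.
have := ext_anti (@l1seq_closed _ _ L) (bb N.+1) hb.
move=> /(ext_blocks (blocks_nil f N)) /ext_cat h.
rewrite -[s]cats0; apply: h => u [lu fu].
by apply: (l1seq_glue K0 L0 _ sep lu fu); case: ls.
Qed.

Lemma l1seq_ext K s t : l1seq K (s ++ t) -> ext (l1seq K) (onat (size t)) s.
Proof.
elim: t s => [|x t ih] s; first by rewrite cats0.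
by rewrite -cat_rcons => /ih h; exists x.
Qed.

(** Adding to an [l1] sequence a unit vector on which the separating functionals
    vanish gives an [l1] sequence; the constant may grow with [n]. *)
Lemma attained_onat n : infinite_dimensional X -> attained (onat n).
Proof.
move=> infX; elim: n => [|n [K [K1 /ext_onat[s [sn ls]]]]].
  by exists 1; split=> //; exact: l1seq_nil.
have K0 : 0 < K by lra.
have [f [N sep]] := separating_functionals K0 ls.
have [y [y1 fy]] := unit_annihilated f N infX.
have ly : l1seq 1 [:: y].
  split=> [x|a]; first by rewrite inE => /eqP ->.
  by rewrite /l1 /lc !big_ord1 normrZ y1 mulr1 mul1r.
exists (glue_const K 1); split.
  rewrite /glue_const; lra.
rewrite -sn -[(size s).+1]addn1 -(size_cat s [:: y]).
apply: (@l1seq_ext _ [::]); apply: (l1seq_glue K0 ltr01 _ sep ly).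
  by case: ls.
by move=> x; rewrite inE => /eqP ->.
Qed.

End Blocks.

(** * The index in terms of attained ordinals *)

Section Index.
Context (R : realType) (X : completeNormedModType R).
Implicit Types (s t : seq X) (x y : X) (K : R).

(** The lower estimates of the finite pieces of a branch share the constant [K],
    so that they pass to the limit. *)
Lemma contains_l1_branch K (x : nat -> X) : 0 < K ->
  (forall n, l1seq K (mkseq x n)) -> contains_l1 X.
Proof.
move=> K0 hx.
have x1 n : `|x n| = 1.
  by have [ux _] := hx n.+1; apply: ux; rewrite mkseqS mem_rcons mem_head.
have normed a : [normed series (fun n => a n *: x n)] = series (fun n => `|a n|).
  by apply/funext => n; apply: eq_bigr => i _ /=; rewrite normrZ x1 mulr1.
have cx a : l1_summable a -> cvgn (series (fun n => a n *: x n)).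
  by move=> sa; apply: normed_cvg; rewrite normed.
have l1le a n : series (fun n => `|a n|) n <= K * `|series (fun n => a n *: x n) n|.
  have [_ /(_ a)] := hx n; rewrite /l1 /lc size_mkseq /series/= !big_mkord => h.
  apply: le_trans h _; rewrite (eq_bigr (fun i : 'I_n => a i *: x i))// => i _.
  by rewrite nth_mkseq.
exists (fun a => limn (series (fun n => a n *: x n))); split.
  move=> s a b sa sb; apply: cvg_lim => //.
  rewrite (_ : series _ =
      s \*: series (fun n => a n *: x n) + series (fun n => b n *: x n)).
    by apply: cvgD; [apply: cvgZr; exact: cx|exact: cx].
  apply/funext => n.
  transitivity
    (s *: series (fun n => a n *: x n) n + series (fun n => b n *: x n) n) => //.
  rewrite /series/= scaler_sumr -big_split/=.
  by apply: eq_bigr => i _; rewrite scalerDl scalerA.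
exists K^-1, 1; split; rewrite ?invr_gt0// => a sa; apply/andP; split.
  rewrite ler_pdivrMl//.
  have cn : (fun n => K * `|series (fun n => a n *: x n) n|) @ \oo -->
      K * `|limn (series (fun n => a n *: x n))|.
    by apply: cvgM; [exact: cvg_cst|apply: cvg_norm; exact: cx].
  rewrite -(cvg_lim _ cn)//; apply: ler_lim => //.
    by apply/cvg_ex; eexists; exact: cn.
  by near=> n; exact: l1le.
rewrite mul1r; have := @lim_series_norm _ _ (fun n => a n *: x n).
by rewrite normed; apply.
Unshelve. all: by end_near. Qed.

Lemma is_l1_tree_l1seq K (T : set (seq X)) :
  is_l1_tree K T -> T `<=` full_tree (l1seq K).
Proof.
move=> [_ hT] s /hT[s0 us [c [C [c0 C0 cC h]]]]; split; first by case: (s) s0.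
(* The upper estimate for the first vector alone. *)
have C1 : 1 <= C.
  pose i0 := Ordinal s0; have /andP[_] := h (fun i => (i == i0)%:R).
  rewrite (bigD1 i0)//= big1 => [|i /negPf ->]; last by rewrite scale0r.
  rewrite (bigD1 i0)//= big1 => [|i /negPf ->]; last by rewrite normr0.
  by rewrite scale1r !addr0 normr1 mulr1 us// mem_nth.
split=> // a; have /andP[h1 _] := h (fun i => a i).
move: h1; rewrite -ler_pdivlMl// => h1; apply: le_trans h1 _.
apply: ler_wpM2r => //; apply: le_trans cC; rewrite ler_peMr// invr_ge0; exact: ltW.
Qed.

Lemma l1seq_bounds K s : 1 <= K -> s <> [::] -> l1seq K s ->
  [/\ (0 < size s)%N, forall x, x \in s -> unit_sphere x &
    exists c C : R, [/\ 0 < c, 0 < C, c^-1 * C <= K &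
      forall a : 'I_(size s) -> R,
        c * \sum_(i < size s) `|a i| <= `|\sum_(i < size s) a i *: s`_i|
          <= C * \sum_(i < size s) `|a i|]].
Proof.
move=> K1 s0 [us hs]; have K0 : 0 < K by lra.
split=> //; first by case: (s) s0.
exists K^-1, 1; split; rewrite ?invr_gt0// ?invrK ?mulr1// => a.
pose b i := if insub i is Some j then a j else 0.
have := hs b; have := norm_lc b us; rewrite /lc /l1.
rewrite (eq_bigr (fun i => a i *: s`_i)); last by move=> i _; rewrite /b valK.
rewrite (eq_bigr (fun i => `|a i|)); last by move=> i _; rewrite /b valK.
by move=> h1 h2; rewrite mul1r h1 ler_pdivrMl// h2.
Qed.

Lemma lt_tree_order (T : set (seq X)) b :
  olt b (tree_order (@prefix X) T) -> Defs.deriv (@prefix X) T b !=set0.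
Proof.
move=> h; apply/set0P/negP => /eqP e; apply: (@olt_irr b).
pose P a := Defs.deriv (@prefix X) T a = set0.
have [_ /(_ b e)] := oinfP (ex_intro P b e).
exact: ole_trans h.
Qed.

Lemma tree_order_gt (T : set (seq X)) a b : Defs.deriv (@prefix X) T a = set0 ->
  Defs.deriv (@prefix X) T b !=set0 -> olt b (tree_order (@prefix X) T).
Proof.
move=> Ta [x Tb]; have [h|//] := ole_or_olt (tree_order (@prefix X) T) b.
have [T0 _] := oinfP (ex_intro (fun a => Defs.deriv (@prefix X) T a = set0) a Ta).
have := deriv_anti h Tb; rewrite T0; case.
Qed.

Lemma full_tree_deriv_nonempty (G : seq X -> Prop) b : prefix_closed G ->
  Defs.deriv (@prefix X) (full_tree G) b !=set0 <-> ext G (osucc b) [::].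
Proof.
move=> Gc; split=> [[[|x s]]|[x hx]].
- by case/(deriv_full_tree b [::] Gc).
- case/(deriv_full_tree b _ Gc) => _ h; exists x.
  exact: (@prefix_closed_cat _ _ (ext_closed Gc (a := b)) [:: x] s).
- by exists [:: x]; apply/deriv_full_tree.
Qed.

Lemma index_attained b : olt b (l1_index X) -> attained X (osucc b).
Proof.
case/olt_olubP => -[K K1] /olt_olubP[[T hT]] /= /lt_tree_order[s hs].
exists K; split=> //; apply/(full_tree_deriv_nonempty b (@l1seq_closed _ _ K)).
exists s; apply: deriv_sub hs; exact: is_l1_tree_l1seq.
Qed.

Section Separable.
Context (sepX : separable X) (nl1 : ~ contains_l1 X).

Lemma dense_sequence : exists e : nat -> X, forall x (d : R), `|x| = 1 -> 0 < d ->
  exists k, `|e k| = 1 /\ `|x - e k| <= d.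
Proof.
have [A /countable_injP[r rinj] dA] := sepX.
pose g k := if pselect (exists2 x, A x & r x = k) is left h then
  projT1 (cid2 h) else 0.
have gr x : A x -> g (r x) = x.
  move=> Ax; rewrite /g; case: pselect => [h|[]]; last by exists x.
  by case: cid2 => y Ay e /=; apply: rinj; rewrite ?inE.
exists (fun k => `|g k|^-1 *: g k) => x d x1 d0.
(* Normalising [y] moves it by at most its distance to [x]; the bound 1/2 keeps
   [y] away from zero. *)
pose d' := Num.min (d / 2) (2^-1).
have d'0 : 0 < d' by rewrite lt_min; apply/andP; split; lra.
have d'd : d' <= d / 2 by rewrite ge_min lexx.
have d'1 : d' <= 2^-1 by rewrite ge_min lexx orbT.
have [|y [xy Ay]] := dA (ball x d') _ (ball_open x d').
  by exists x; exact: ballxx.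
exists (r y); rewrite gr//.
have {}xy : `|x - y| < d' by move: xy; rewrite -ball_normE.
have yn : `| `|y| - 1| <= d'.
  by rewrite -x1 distrC; apply: le_trans (ler_dist_dist _ _) (ltW xy).
have y0 : 0 < `|y| by move: yn; rewrite ler_norml => /andP[? _]; lra.
split; first by rewrite normrZ normfV normr_id mulVf// gt_eqF.
have -> : x - `|y|^-1 *: y = (x - y) + (1 - `|y|^-1) *: y.
  by rewrite scalerBl scale1r addrA subrK.
apply: le_trans (ler_normD _ _) _; rewrite normrZ.
rewrite -[X in _ * X](normr_id y) -normrM mulrBl mul1r mulVf ?gt_eqF//; lra.
Qed.

(** Sequences drawn from a fixed countable set, so that the full tree of
    such [l1] sequences is countable. *)
Definition l1seq_in (e : nat -> X) K s :=
  l1seq K s /\ forall x, x \in s -> exists k, x = e k.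

Lemma l1seq_in_closed e K : prefix_closed (l1seq_in e K).
Proof.
move=> s x [/l1seq_closed ls es]; split=> // y ys; apply: es.
by rewrite mem_rcons inE ys orbT.
Qed.

Lemma l1seq_in_map e K s : l1seq_in e K s -> exists l, s = map e l.
Proof.
move=> [_]; elim: s => [_|x s ih es]; first by exists [::].
have [k ->] := es x (mem_head _ _).
have [|l ->] := ih; first by move=> y ys; apply: es; rewrite inE ys orbT.
by exists (k :: l).
Qed.

Lemma l1seq_in_bounded e K : 0 < K -> exists a, ~ ext (l1seq_in e K) a [::].
Proof.
move=> K0; apply: ext_bounded (@l1seq_in_closed e K) _ => x hx.
by apply: nl1; apply: (contains_l1_branch K0 (x := x)) => n; case: (hx n).
Qed.

Lemma l1seq_in_tree e K : 1 <= K -> full_tree (l1seq_in e K) !=set0 ->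
  is_l1_tree K (full_tree (l1seq_in e K)).
Proof.
move=> K1 ne; split=> [|s [s0 [ls _]]]; last exact: l1seq_bounds.
apply: full_tree_is_tree ne.
apply: (@sub_countable _ _ _ [set map e l | l in [set: seq nat]]).
  by apply: subset_card_le => s /l1seq_in_map[l ->]; exists l.
exact: sub_countable (card_image_le _ _) (countableP _).
Qed.

(** Each unit vector is replaced by a nearby term of [e], always the same one, so
    that extensions of sequences are respected. *)
Lemma attained_in b : attained X b -> forall e,
  (forall x (d : R), `|x| = 1 -> 0 < d -> exists k, `|e k| = 1 /\ `|x - e k| <= d) ->
  exists n : nat, 1 <= n%:R :> R /\ ext (l1seq_in e n%:R) b [::].
Proof.
move=> [K [K1 hK]] e de; have d0 : 0 < (2 * K)^-1 by rewrite invr_gt0; lra.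
have /choice[h hP] x : exists y, `|x| = 1 ->
    [/\ `|y| = 1, `|x - y| <= (2 * K)^-1 & exists k, y = e k].
  have [x1|/eqP x1] := eqVneq `|x| 1; last by exists 0.
  by have [k [ek xk]] := de x _ x1 d0; exists (e k); split=> //; exists k.
pose n := (Num.truncn (2 * K)).+1; have Kn : 2 * K < n%:R := truncnS_gt _.
exists n; split; first by lra.
apply: (ext_map (h := h) (s := [::])) hK => s ls; split.
  apply: l1seq_le (ltW Kn) _; apply: l1seq_perturb K1 _ ls => x x1.
  by have [] := hP x x1.
by move=> _ /mapP[x xs ->]; have [_ _] := hP x (ls.1 x xs).
Qed.

(** Attained ordinals are attained by a countable tree, which is well-founded
    because an infinite branch would span [l1]. *)
Lemma attained_index b : attained X (osucc b) -> olt b (l1_index X).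
Proof.
move=> hb; have [e de] := dense_sequence.
have [n [n1 hn]] := attained_in hb de.
have Gc := @l1seq_in_closed e n%:R.
have [a na] : exists a, ~ ext (l1seq_in e n%:R) a [::].
  by apply: l1seq_in_bounded; exact: lt_le_trans ltr01 n1.
have Tb := (full_tree_deriv_nonempty b Gc).2 hn.
have ht : is_l1_tree n%:R (full_tree (l1seq_in e n%:R)).
  apply: l1seq_in_tree n1 _; case: Tb => s hs; exists s.
  exact: (deriv_anti (a := ozero) (b := b)) hs.
apply/olt_olubP; exists (exist _ n%:R n1); apply/olt_olubP; exists (exist _ _ ht).
apply: (tree_order_gt (a := a) _ Tb); apply/seteqP; split=> // s hs.
have [_ h] := (deriv_full_tree a s Gc).1 hs; apply: na.
exact: (@prefix_closed_cat _ _ (ext_closed Gc (a := a)) [::] s).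
Qed.

(** An ordinal below the index is recovered from any sequence that survives
    exactly that many derivations in one of countably many countable trees. *)
Lemma l1_index_countable : olt_omega1 (l1_index X).
Proof.
have [e de] := dense_sequence.
pose r (p : nat * seq nat) :=
  oinf (fun a => ~ ext (l1seq_in e p.1%:R) (osucc a) (map e p.2)).
exists (fun k => if unpickle k is Some p then r p else ozero) => b.
move=> /index_attained/attained_in/(_ e de)[n [n1 hn]].
have Gc := @l1seq_in_closed e n%:R.
have [a na] : exists a, ~ ext (l1seq_in e n%:R) a [::].
  by apply: l1seq_in_bounded; exact: lt_le_trans ltr01 n1.
have [s [bs nbs]] := ext_top Gc na (ext_anti Gc (ole_succr (ole_refl b)) hn).
have [l sl] := l1seq_in_map (ext_base Gc bs); rewrite {s}sl in bs nbs.
exists (pickle (n, l)).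
rewrite pickleK /r/=; set P := fun a => _.
have [Pm min] := oinfP (ex_intro P b nbs); split; last exact: min.
have [//|lt] := ole_or_olt b (oinf P); case: Pm.
exact: (ext_anti Gc (a := osucc (oinf P)) lt bs).
Qed.

End Separable.
End Index.

(** * Indecomposability of the index *)

Theorem theorem5p9 (R : realType) (X : completeNormedModType R) :
  infinite_dimensional X -> separable X -> ~ contains_l1 X ->
  exists alpha : ord, olt_omega1 alpha /\ oeq (l1_index X) (omega_exp alpha).
Proof.
move=> infX sepX nl1; set I := l1_index X.
have gtI b : attained X (osucc b) -> olt b I by exact: attained_index.
have geomega : ole omega I.
  by move=> n; apply/olt_ole/gtI; exact: (attained_onat n.+1 infX).
have [|a [leI ltI]] := @leading_exponent I.
  exact: ole_trans (onat_le_omega 1) geomega.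
exists a; split.
  have [s hs] := l1_index_countable sepX nl1; exists s => b ba; apply: hs.
  exact: ole_trans ba (ole_trans (ole_omega_exp a) leI).
split=> //; set W := omega_exp a in leI ltI *.
have [//|WI] := ole_or_olt I W; exfalso; apply: (@olt_irr I).
(* It suffices that [W * omega <= I]. If [W <= 1], this is [omega <= I]. *)
apply: (ole_trans ltI); case: (omega_exp_absorb a) => [W1|[_ absW]].
  apply: ole_trans geomega; apply: (ole_trans (omul_mono_l omega W1)).
  exact: omul_onat_omega 1%N.
have attW : attained X W.
  exact: attained_le (ole_succr (ole_refl W)) (index_attained WI).
have attWn n : attained X (omul W (onat n)).
  elim: n => [|n ih]; first exact: attained_onat 0%N infX.
  exact: attained_oadd (fun m => omul_absorb _ (absW m)) attW ih.
move=> n; apply/olt_ole/gtI; apply: attained_le (attWn n.+1).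
exact: (oadd_mono_r (omul W (onat n)) (omega_exp_gt0 a)).
Qed.
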